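(* Let $P$, $Q$, $R$ be Interface Automata with common input alphabet $I$ and common output alphabet $O$, where $P$ and $Q$ have disjoint state sets, and let $p\in P$, $q\in Q$, $r\in R$. Then $r\sqsubseteq_{\mathrm{IA}} p$ and $r\sqsubseteq_{\mathrm{IA}} q$ if and only if $r\sqsubseteq_{\mathrm{IA}} p\wedge q$, where $p\wedge q$ is the corresponding state of the IA-conjunction $P\wedge Q$.
   Context: An Interface Automaton (IA) is a tuple $P=(P,I,O,\rightarrow_P)$ where $P$ is a set of states, $I$ and $O$ are disjoint sets of input and output actions not containing the special silent action $\tau$, and $\rightarrow_P\subseteq P\times(I\cup O\cup\{\tau\})\times P$ is a transition relation that is input-deterministic: for $a\in I$, $p\xrightarrow{a}p'$ and $p\xrightarrow{a}p''$ imply $p'=p''$. Write $p\xrightarrow{a}$ if $p\xrightarrow{a}p'$ for some $p'$, and $p\not\xrightarrow{a}$ otherwise. Weak transitions: $p\stackrel{\epsilon}{\Rightarrow}p'$ iff $p(\xrightarrow{\tau})^*p'$; for $o\in O$, $p\stackrel{o}{\Rightarrow}p'$ iff there is $p''$ with $p\stackrel{\epsilon}{\Rightarrow}p''\xrightarrow{o}p'$. For $\alpha\in I\cup O\cup\{\tau\}$ let $\hat\alpha=\epsilon$ if $\alpha=\tau$ and $\hat\alpha=\alpha$ otherwise. For IAs $P,Q$ with the same input alphabet $I$ and output alphabet $O$, a relation $\mathcal R\subseteq P\times Q$ is an alternating simulation if for all $(p,q)\in\mathcal R$: (i) if $q\xrightarrow{a}q'$ with $a\in I$, then there is $p'$ with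 $p\xrightarrow{a}p'$ and $(p',q')\in\mathcal R$; (ii) if $p\xrightarrow{\alpha}p'$ with $\alpha\in O\cup\{\tau\}$, then there is $q'$ with $q\stackrel{\hat\alpha}{\Rightarrow}q'$ and $(p',q')\in\mathcal R$. Write $p\sqsubseteq_{\mathrm{IA}}q$ if some alternating simulation contains $(p,q)$. IA-conjunction: for IAs $P=(P,I,O,\rightarrow_P)$ and $Q=(Q,I,O,\rightarrow_Q)$ with disjoint state sets, $P\wedge Q$ is the IA with state set $\{p\wedge q: p\in P, q\in Q\}\cup P\cup Q$, alphabets $I,O$, and the least transition relation containing $\rightarrow_P$ and $\rightarrow_Q$ and satisfying: (I1) $p\wedge q\xrightarrow{a}p'$ if $p\xrightarrow{a}_Pp'$, $q\not\xrightarrow{a}_Q$ and $a\in I$; (I2) $p\wedge q\xrightarrow{a}q'$ if $p\not\xrightarrow{a}_P$, $q\xrightarrow{a}_Qq'$ and $a\in I$; (I3) $p\wedge q\xrightarrow{a}p'\wedge q'$ if $p\xrightarrow{a}_Pp'$, $q\xrightarrow{a}_Qq'$ and $a\in I$; (O) $p\wedge q\xrightarrow{a}p'\wedge q'$ if $p\xrightarrow{a}_Pp'$, $q\xrightarrow{a}_Qq'$ and $a\in O$; (T1) $p\wedge q\xrightarrow{\tau}p'\wedge q$ if $p\xrightarrow{\tau}_Pp'$; (T2) $p\wedge q\xrightarrow{\tau}p\wedge q'$ if $q\xrightarrow{\tau}_Qq'$. *)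

(* Defs.v *)
From Stdlib Require Import Relations.

Set Implicit Arguments.

(* The input and output alphabets are two types [I] and [O].  Labels are tagged,
   so [I] and [O] are disjoint and neither of them contains tau. *)
Inductive label (I O : Type) : Type :=
| Input (a : I)
| Output (o : O)
| Tau.

Arguments Input {I O} a.
Arguments Output {I O} o.
Arguments Tau {I O}.

Definition is_input {I O : Type} (l : label I O) : Prop :=
  exists a, l = Input a.

Record IA (I O : Type) : Type := MkIA {
  state :> Type;
  trans : state -> label I O -> state -> Prop;
  input_deterministic : forall (a : I) (p p' p'' : state),
    trans p (Input a) p' -> trans p (Input a) p'' -> p' = p''
}.

Arguments trans {I O i} _ _ _.

Definition enabled {I O : Type} {P : IA I O} (p : P) (l : label I O) : Prop :=
  exists p' : P, trans p l p'.

Definition tau_step {I O : Type} (P : IA I O) (p p' : P) : Prop :=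
  trans p Tau p'.

(* [None] stands for the empty word epsilon.  There are no tau-steps after the
   visible action. *)
Definition weak_trans {I O : Type} {P : IA I O}
    (p : P) (w : option (label I O)) (p' : P) : Prop :=
  match w with
  | None => clos_refl_trans P (@tau_step I O P) p p'
  | Some l => exists p'' : P,
      clos_refl_trans P (@tau_step I O P) p p'' /\ trans p'' l p'
  end.

Definition hat {I O : Type} (l : label I O) : option (label I O) :=
  match l with
  | Tau => None
  | _ => Some l
  end.

Definition alternating_simulation {I O : Type} (P Q : IA I O)
    (S : P -> Q -> Prop) : Prop :=
  forall (p : P) (q : Q), S p q ->
    (forall (a : I) (q' : Q), trans q (Input a) q' ->
       exists p' : P, trans p (Input a) p' /\ S p' q') /\
    (forall (l : label I O) (p' : P), ~ is_input l -> trans p l p' ->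
       exists q' : Q, weak_trans q (hat l) q' /\ S p' q').

Definition ia_refines {I O : Type} {P Q : IA I O} (p : P) (q : Q) : Prop :=
  exists S : P -> Q -> Prop, alternating_simulation P Q S /\ S p q.

(* The tags make the three parts of the state set of the conjunction disjoint,
   even when [P] and [Q] have the same type of states. *)
Inductive conj_state (P Q : Type) : Type :=
| Both (p : P) (q : Q)
| OnlyL (p : P)
| OnlyR (q : Q).

Arguments Both {P Q} p q.
Arguments OnlyL {P Q} p.
Arguments OnlyR {P Q} q.

Inductive conj_trans {I O : Type} (P Q : IA I O) :
    conj_state P Q -> label I O -> conj_state P Q -> Prop :=
| conj_L (p p' : P) (l : label I O) :
    trans p l p' -> conj_trans P Q (OnlyL p) l (OnlyL p')
| conj_R (q q' : Q) (l : label I O) :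
    trans q l q' -> conj_trans P Q (OnlyR q) l (OnlyR q')
| conj_I1 (p p' : P) (q : Q) (a : I) :
    trans p (Input a) p' -> ~ enabled q (Input a) ->
    conj_trans P Q (Both p q) (Input a) (OnlyL p')
| conj_I2 (p : P) (q q' : Q) (a : I) :
    ~ enabled p (Input a) -> trans q (Input a) q' ->
    conj_trans P Q (Both p q) (Input a) (OnlyR q')
| conj_I3 (p p' : P) (q q' : Q) (a : I) :
    trans p (Input a) p' -> trans q (Input a) q' ->
    conj_trans P Q (Both p q) (Input a) (Both p' q')
| conj_O (p p' : P) (q q' : Q) (o : O) :
    trans p (Output o) p' -> trans q (Output o) q' ->
    conj_trans P Q (Both p q) (Output o) (Both p' q')
| conj_T1 (p p' : P) (q : Q) :
    trans p Tau p' -> conj_trans P Q (Both p q) Tau (Both p' q)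
| conj_T2 (p : P) (q q' : Q) :
    trans q Tau q' -> conj_trans P Q (Both p q) Tau (Both p q').

Lemma conj_input_deterministic {I O : Type} (P Q : IA I O)
    (a : I) (x y z : conj_state P Q) :
  conj_trans P Q x (Input a) y -> conj_trans P Q x (Input a) z -> y = z.
Proof.
  intros Hy Hz; inversion Hy; subst; inversion Hz; subst;
    try (exfalso; unfold enabled in *; now eauto);
    repeat f_equal; eapply input_deterministic; eassumption.
Qed.

Definition ia_conj {I O : Type} (P Q : IA I O) : IA I O :=
  MkIA (conj_trans P Q) (@conj_input_deterministic I O P Q).

Definition conj_pair {I O : Type} {P Q : IA I O} (p : P) (q : Q) :
    ia_conj P Q :=
  Both p q.

(* Main.v *)
(* The conjunction is the meet for refinement. It refines both conjuncts, and
   refinement is transitive, which gives one direction. Conversely, simulations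
   of [p] and of [q] by [r] combine into one of [p ∧ q]: a shared input leads to
   the same state of [R] in both by input determinism, and weak transitions of
   [p] and [q] interleave into one of [p ∧ q] because no tau-step follows the
   visible action. *)
From Stdlib Require Import Relations Classical.
Require Import Defs.

(** Each single tau-step is answered by a tau-sequence. Keeping [q] general in the induction lets
    the answers be chained. *)
Lemma alternating_simulation_tau_star {I O : Type} (P Q : IA I O)
    (S : P -> Q -> Prop) (p p' : P) :
  alternating_simulation P Q S -> weak_trans p None p' ->
  forall q : Q, S p q -> exists q' : Q, weak_trans q None q' /\ S p' q'.
Proof.
  intros HS Hp; induction Hp as [p p' Hp | p | p p1 p' _ IH1 _ IH2];
    intros q Hpq.
  - apply (proj2 (HS p q Hpq) Tau p'); [intros [a Ha]; discriminate | exact Hp].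
  - exists q; split; [apply rt_refl | exact Hpq].
  - destruct (IH1 q Hpq) as (q1 & Hq1 & Hpq1).
    destruct (IH2 q1 Hpq1) as (q' & Hq' & Hpq').
    exists q'; split; [exact (rt_trans _ _ _ _ _ Hq1 Hq') | exact Hpq'].
Qed.

(** Needed for transitivity: the middle automaton answers with a weak transition, which the next
    simulation must match in turn. *)
Lemma alternating_simulation_weak {I O : Type} (P Q : IA I O)
    (S : P -> Q -> Prop) (p p' : P) (q : Q) (l : label I O) :
  alternating_simulation P Q S -> ~ is_input l -> S p q ->
  weak_trans p (hat l) p' ->
  exists q' : Q, weak_trans q (hat l) q' /\ S p' q'.
Proof.
  intros HS Hl Hpq Hp; destruct l as [a | o |]; simpl in Hp.
  - exfalso; apply Hl; now exists a.
  - destruct Hp as (p1 & Hp1 & Hp').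
    destruct (alternating_simulation_tau_star P Q S p p1 HS Hp1 q Hpq)
      as (q1 & Hq1 & Hpq1).
    (* The answer to the output may begin with tau-steps; these are appended to those from [q] to
       [q1]. *)
    destruct (proj2 (HS p1 q1 Hpq1) (Output o) p' Hl Hp')
      as (q' & (q2 & Hq2 & Hq') & Hpq').
    exists q'; split; [exists q2; split | exact Hpq'].
    + exact (rt_trans _ _ _ _ _ Hq1 Hq2).
    + exact Hq'.
  - exact (alternating_simulation_tau_star P Q S p p' HS Hp q Hpq).
Qed.

(** The relational composite is a simulation: inputs are matched from [r] back to [p], outputs and
    tau from [p] forward to [r]. *)
Lemma ia_refines_trans {I O : Type} (P Q R : IA I O) (p : P) (q : Q) (r : R) :
  ia_refines p q -> ia_refines q r -> ia_refines p r.
Proof.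
  intros (S & HS & Hpq) (T & HT & Hqr).
  exists (fun x z => exists y, S x y /\ T y z); split; [| now exists q].
  clear p q r Hpq Hqr; intros p r (q & Hpq & Hqr); split.
  - intros a r' Hr.
    destruct (proj1 (HT q r Hqr) a r' Hr) as (q' & Hq & Hqr').
    destruct (proj1 (HS p q Hpq) a q' Hq) as (p' & Hp & Hpq').
    exists p'; split; [exact Hp | now exists q'].
  - intros l p' Hl Hp.
    destruct (proj2 (HS p q Hpq) l p' Hl Hp) as (q' & Hq & Hpq').
    destruct (alternating_simulation_weak Q R T q q' r l HT Hl Hqr Hq)
      as (r' & Hr & Hqr').
    exists r'; split; [exact Hr | now exists q'].
Qed.

Lemma weak_trans_refl {I O : Type} (P : IA I O) (p : P) :
  weak_trans p (hat Tau) p.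
Proof. apply rt_refl. Qed.

Lemma trans_weak {I O : Type} (P : IA I O) (p p' : P) (l : label I O) :
  trans p l p' -> weak_trans p (hat l) p'.
Proof.
  intros Hp; destruct l; simpl; try (now apply rt_step);
    exists p; split; trivial; apply rt_refl.
Qed.

(** The relation projects to the left component. It includes the states [OnlyL p] because rule (I1)
    leads there. *)
Lemma ia_conj_refines_l {I O : Type} (P Q : IA I O) (p : P) (q : Q) :
  ia_refines (conj_pair p q) p.
Proof.
  exists (fun (x : ia_conj P Q) p =>
            x = OnlyL p \/ exists q, x = Both p q).
  split; [| right; now exists q].
  clear p q; intros x p Hx; split.
  - intros a p' Hp; destruct Hx as [-> | [q ->]].
    + exists (OnlyL p'); split; [now apply conj_L | now left].
    (* Excluded middle decides between (I3) and (I1), whose premise is negative. *)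
    + destruct (classic (enabled q (Input a))) as [[q' Hq] | Hq].
      * exists (Both p' q'); split; [now apply conj_I3 | right; now exists q'].
      * exists (OnlyL p'); split; [now apply conj_I1 | now left].
  - intros l x' Hl Hx'; simpl in Hx'.
    destruct Hx as [-> | [q ->]]; inversion Hx'; subst;
      try (exfalso; apply Hl; eexists; reflexivity);
      (* A tau-step of [q] alone is answered by staying at [p], every other move by the underlying
         transition of [P]. *)
      eauto 7 using trans_weak, weak_trans_refl.
Qed.

Lemma ia_conj_refines_r {I O : Type} (P Q : IA I O) (p : P) (q : Q) :
  ia_refines (conj_pair p q) q.
Proof.
  exists (fun (x : ia_conj P Q) q =>
            x = OnlyR q \/ exists p, x = Both p q).
  split; [| right; now exists p].
  clear p q; intros x q Hx; split.
  - intros a q' Hq; destruct Hx as [-> | [p ->]].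
    + exists (OnlyR q'); split; [now apply conj_R | now left].
    + destruct (classic (enabled p (Input a))) as [[p' Hp] | Hp].
      * exists (Both p' q'); split; [now apply conj_I3 | right; now exists p'].
      * exists (OnlyR q'); split; [now apply conj_I2 | now left].
  - intros l x' Hl Hx'; simpl in Hx'.
    destruct Hx as [-> | [p ->]]; inversion Hx'; subst;
      try (exfalso; apply Hl; eexists; reflexivity);
      eauto 7 using trans_weak, weak_trans_refl.
Qed.

Lemma clos_refl_trans_map {A B : Type} (R : relation A) (S : relation B)
    (f : A -> B) (x y : A) :
  (forall u v, R u v -> S (f u) (f v)) ->
  clos_refl_trans A R x y -> clos_refl_trans B S (f x) (f y).
Proof.
  intros Hf Hxy; induction Hxy; eauto using clos_refl_trans.
Qed.

Lemma conj_tau_star {I O : Type} (P Q : IA I O) (p p' : P) (q q' : Q) :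
  weak_trans p None p' -> weak_trans q None q' ->
  weak_trans (conj_pair p q) None (conj_pair p' q').
Proof.
  intros Hp Hq; apply rt_trans with (conj_pair p' q).
  - apply clos_refl_trans_map with (f := fun p => conj_pair p q) (2 := Hp).
    intros u v Huv; now apply conj_T1.
  - apply clos_refl_trans_map with (f := fun q => conj_pair p' q) (2 := Hq).
    intros u v Huv; now apply conj_T2.
Qed.

(** [OnlyL] embeds [P] with its transitions, so whole tau-sequences are carried over. *)
Lemma conj_weak_only_l {I O : Type} (P Q : IA I O) (p p' : P)
    (w : option (label I O)) :
  weak_trans p w p' ->
  weak_trans (P := ia_conj P Q) (OnlyL p) w (OnlyL p').
Proof.
  assert (Htau : forall u v : P, tau_step P u v ->
            tau_step (ia_conj P Q) (OnlyL u) (OnlyL v)) by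
    (intros u v; apply conj_L).
  destruct w as [l |]; simpl.
  - intros (p1 & Hp1 & Hp'); exists (OnlyL p1); split; [| now apply conj_L].
    exact (clos_refl_trans_map _ _ OnlyL _ _ Htau Hp1).
  - exact (clos_refl_trans_map _ _ OnlyL _ _ Htau).
Qed.

Lemma conj_weak_only_r {I O : Type} (P Q : IA I O) (q q' : Q)
    (w : option (label I O)) :
  weak_trans q w q' ->
  weak_trans (P := ia_conj P Q) (OnlyR q) w (OnlyR q').
Proof.
  assert (Htau : forall u v : Q, tau_step Q u v ->
            tau_step (ia_conj P Q) (OnlyR u) (OnlyR v)) by
    (intros u v; apply conj_R).
  destruct w as [l |]; simpl.
  - intros (q1 & Hq1 & Hq'); exists (OnlyR q1); split; [| now apply conj_R].
    exact (clos_refl_trans_map _ _ OnlyR _ _ Htau Hq1).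
  - exact (clos_refl_trans_map _ _ OnlyR _ _ Htau).
Qed.

(** All tau-steps of both sides are performed first, by (T1) and (T2); then the two sides
    synchronise on the output by (O). *)
Lemma conj_weak_both {I O : Type} (P Q : IA I O) (p p' : P) (q q' : Q)
    (l : label I O) :
  ~ is_input l -> weak_trans p (hat l) p' -> weak_trans q (hat l) q' ->
  weak_trans (conj_pair p q) (hat l) (conj_pair p' q').
Proof.
  intros Hl; destruct l as [a | o |].
  - exfalso; apply Hl; now exists a.
  - intros (p1 & Hp1 & Hp') (q1 & Hq1 & Hq'); exists (conj_pair p1 q1); split.
    + exact (conj_tau_star P Q p p1 q q1 Hp1 Hq1).
    + now apply conj_O.
  - apply conj_tau_star.
Qed.

Lemma ia_conj_greatest {I O : Type} (P Q R : IA I O) (p : P) (q : Q) (r : R) :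
  ia_refines r p -> ia_refines r q -> ia_refines r (conj_pair p q).
Proof.
  intros (S & HS & Hp) (T & HT & Hq).
  (* After (I1) or (I2) only one conjunct remains, so only its simulation is required. *)
  exists (fun r (x : ia_conj P Q) =>
            match x with
            | Both p q => S r p /\ T r q
            | OnlyL p => S r p
            | OnlyR q => T r q
            end).
  split; [| now split].
  clear p q r Hp Hq; intros r x Hx; split.
  - intros a x' Hx'; simpl in Hx'; remember (Input a) as l eqn:Hl.
    destruct Hx' as [p p' l Hp | q q' l Hq | p p' q b Hp _ | p q q' b _ Hq
      | p p' q q' b Hp Hq | | |]; try discriminate Hl;
      [subst l | subst l | injection Hl as -> ..].
    + exact (proj1 (HS _ _ Hx) _ _ Hp).
    + exact (proj1 (HT _ _ Hx) _ _ Hq).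
    + exact (proj1 (HS _ _ (proj1 Hx)) _ _ Hp).
    + exact (proj1 (HT _ _ (proj2 Hx)) _ _ Hq).
    + destruct (proj1 (HS _ _ (proj1 Hx)) _ _ Hp) as (r1 & Hr1 & HS1).
      destruct (proj1 (HT _ _ (proj2 Hx)) _ _ Hq) as (r2 & Hr2 & HT2).
      (* The two simulations choose [r1] and [r2] independently; determinism of [R] identifies
         them. *)
      rewrite <- (input_deterministic _ _ _ _ _ Hr1 Hr2) in HT2.
      exists r1; auto.
  - intros l r' Hl Hr; destruct x as [p q | p | q].
    + destruct Hx as [Hp Hq].
      destruct (proj2 (HS _ _ Hp) _ _ Hl Hr) as (p' & Hp' & HSp).
      destruct (proj2 (HT _ _ Hq) _ _ Hl Hr) as (q' & Hq' & HTq).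
      exists (conj_pair p' q'); split; [now apply conj_weak_both | now split].
    + destruct (proj2 (HS _ _ Hx) _ _ Hl Hr) as (p' & Hp' & HSp).
      exists (OnlyL p'); split; [now apply conj_weak_only_l | exact HSp].
    + destruct (proj2 (HT _ _ Hx) _ _ Hl Hr) as (q' & Hq' & HTq).
      exists (OnlyR q'); split; [now apply conj_weak_only_r | exact HTq].
Qed.

Theorem theorem2p4 (I O : Type) (P Q R : IA I O) (p : P) (q : Q) (r : R) :
  (ia_refines r p /\ ia_refines r q) <-> ia_refines r (conj_pair p q).
Proof.
  split.
  - intros [Hp Hq]; now apply ia_conj_greatest.
  - intros Hr; split.
    + exact (ia_refines_trans _ _ _ _ _ _ Hr (ia_conj_refines_l P Q p q)).
    + exact (ia_refines_trans _ _ _ _ _ _ Hr (ia_conj_refines_r P Q p q)).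
Qed.
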